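(* Let $G$ be a finite simple graph that is a cograph or a split graph. Then $G$ has a unique perfect matching if and only if some set $U\subseteq V(G)$ forces a unique perfect matching in $G$.
   Context: A cograph is a graph with no induced path on four vertices. A split graph is a graph whose vertex set can be partitioned into an independent set and a clique. For a graph $G$ with $n(G)$ vertices, a set $U=\{u_1,\ldots,u_k\}$ (with a given ordering) is said to force a unique perfect matching in $G$ if $n(G)=2k$ and $d_{G_i}(u_i)=1$ for every $i\in\{1,\ldots,k\}$, where $G_i=G-\bigcup_{j=1}^{i-1}N_G[u_j]$ and $N_G[u]$ denotes the closed neighborhood of $u$ in $G$. (A set ''forces a unique perfect matching'' if it admits such an ordering.) *)

(* Defs.v *)
From mathcomp Require Import all_boot.

Set Implicit Arguments.
Unset Strict Implicit.
Unset Printing Implicit Defensive.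

Record sgraph := SGraph {
  svertex :> finType;
  sedge : rel svertex;
  sedge_sym : symmetric sedge;
  sedge_irrefl : irreflexive sedge }.

Notation "x -- y" := (sedge x y) (at level 30, no associativity).

Section Graph.
Variable G : sgraph.
Implicit Types (x y u : G) (A U : {set G}) (s : seq G).

Definition induced_path n (f : 'I_n -> G) : Prop :=
  injective f /\
  forall i j : 'I_n, f i -- f j = (j == i.+1 :> nat) || (i == j.+1 :> nat).

Definition cograph : Prop := ~ exists f : 'I_4 -> G, induced_path f.

Definition independent A : Prop := {in A &, forall x y, ~~ (x -- y)}.

Definition clique A : Prop := {in A &, forall x y, x != y -> x -- y}.

(* Either part of the partition may be empty. *)
Definition split_graph : Prop :=
  exists I K : {set G},
    [/\ I :|: K = [set: G], [disjoint I & K], independent I & clique K].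

Definition edges : {set {set G}} :=
  [set e | [exists x, exists y, (x -- y) && (e == [set x; y])]].

Definition matching (M : {set {set G}}) : Prop :=
  M \subset edges /\ trivIset M.

Definition perfect_matching (M : {set {set G}}) : Prop :=
  matching M /\ cover M = [set: G].

Definition has_unique_perfect_matching : Prop :=
  exists! M : {set {set G}}, perfect_matching M.

Definition closed_nbh u : {set G} := [set v | (v == u) || (u -- v)].

(* [has_degree A u d]: u is a vertex of the induced subgraph G[A] and its
   degree in G[A] is d. *)
Definition has_degree A u (d : nat) : Prop :=
  u \in A /\ #|[set v in A | u -- v]| = d.

(* The vertex set of G minus the neighborhoods N_G[u], u in s.  The
   neighborhoods are taken in G, not in the successive subgraphs. *)
Definition remaining s : {set G} := ~: \bigcup_(u <- s) closed_nbh u.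

(* The sequence s orders its elements; with 0-based indices, the i-th one must
   be a vertex of degree 1 once the neighborhoods of its i predecessors have
   been deleted. *)
Definition forces_in_order s : Prop :=
  #|G| = 2 * size s /\
  forall (i : nat) (u0 : G), i < size s ->
    has_degree (remaining (take i s)) (nth u0 s i) 1.

Definition forces_unique_perfect_matching U : Prop :=
  exists s, [/\ uniq s, U = [set u in s] & forces_in_order s].

End Graph.

Arguments cograph : clear implicits.
Arguments split_graph : clear implicits.
Arguments has_unique_perfect_matching : clear implicits.

(* Main.v *)
Require Import Defs.
From mathcomp Require Import all_boot all_fingroup.

(** A perfect matching is a fixed-point-free involution [m] along edges.  If it
is unique then, for every permutation [p] whose moved points form a set
disjoint from its image under [m] and satisfy [x -- m (p x)], conjugating [m]
by [p] gives a second perfect matching unless [p = 1]; this excludes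
[m]-alternating cycles.

In a cograph or a split graph, excluding alternating 4-cycles is enough to find
an independent set [A] containing exactly one end of each matching edge.  The
elements of [A] can then be removed one by one: if every remaining [a] in [A]
had a remaining neighbor other than [m a], then iterating [a |-> m z], with [z]
such a neighbor, would close up into an alternating cycle.

Conversely, the forced edges lie in every perfect matching and, by
cardinality, cover all vertices. *)

Set Implicit Arguments.
Unset Strict Implicit.
Unset Printing Implicit Defensive.

(** * Perfect matchings as fixed-point-free involutions *)

Section Matchings.
Variable G : sgraph.
Implicit Types (x y z u v : G) (A : {set G}) (s : seq G) (m : G -> G).

Definition mating m := involutive m /\ forall x, x -- m x.

Definition unique_mating m := mating m /\ forall m', mating m' -> m' =1 m.

Definition mating_edges m : {set {set G}} := [set [set x; m x] | x : G].

Lemma edge_neq x y : x -- y -> x != y.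
Proof. by apply: contraTneq => ->; rewrite sedge_irrefl. Qed.

Lemma set2_injr x y z : [set x; y] = [set x; z] -> y = z.
Proof.
move=> e; have := set22 x y; have := set22 x z.
rewrite e -{1}e !inE => /orP[/eqP-> /orP[]/eqP//|/eqP-> //].
Qed.

Lemma mating_edges_perfect m : mating m -> perfect_matching (mating_edges m).
Proof.
move=> [mK me]; split; first split.
- apply/subsetP=> e /imsetP[x _ ->]; rewrite inE.
  by apply/existsP; exists x; apply/existsP; exists (m x); rewrite me eqxx.
- apply/trivIsetP=> e f /imsetP[x _ ->] /imsetP[y _ ->] neq.
  apply/pred0P=> z /=; apply/negP=> /andP[zx zy]; case/negP: neq; apply/eqP.
  have edgeE t : z \in [set t; m t] -> [set t; m t] = [set z; m z].
    by case/set2P=> ->; rewrite // mK setUC.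
  by rewrite (edgeE x zx) (edgeE y zy).
- apply/setP=> z; rewrite inE; apply/bigcupP; exists [set z; m z].
    exact: imset_f.
  exact: set21.
Qed.

Lemma perfect_mating_edges (M : {set {set G}}) :
  perfect_matching M -> exists2 m, mating m & M = mating_edges m.
Proof.
move=> [[Medge Mtriv] Mcov].
have edgeP e z : e \in M -> z \in e -> exists2 y, z -- y & e = [set z; y].
  move=> /(subsetP Medge); rewrite inE => /existsP[x /existsP[y]].
  move=> /andP[xy /eqP->] /set2P[->|->]; first by exists y.
  by exists x; rewrite 1?sedge_sym // setUC.
have mateP x : exists y, (x -- y) && ([set x; y] \in M).
  have : x \in cover M by rewrite Mcov inE.
  case/bigcupP=> e eM xe; have [y xy eE] := edgeP e x eM xe.
  by exists y; rewrite xy -eE.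
pose m x := xchoose (mateP x).
have mM x : [set x; m x] \in M by case/andP: (xchooseP (mateP x)).
have me x : x -- m x by case/andP: (xchooseP (mateP x)).
(* Members of [M] are pairwise disjoint, so [z] determines the edge through it; this makes [m] an
   involution. *)
have mU e z : e \in M -> z \in e -> e = [set z; m z].
  move=> eM ze; apply/eqP; apply: contraT => ne.
  move/trivIsetP: Mtriv => /(_ _ _ eM (mM z) ne)/pred0P/(_ z) /=.
  by rewrite ze set21.
exists m.
  split=> // x; apply: (@set2_injr (m x)).
  by rewrite -(mU [set x; m x]) ?set22 // setUC.
apply/setP=> e; apply/idP/imsetP=> [eM|[x _ ->] //].
move: (eM) => /(subsetP Medge); rewrite inE => /existsP[x /existsP[y]].
by move=> /andP[_ /eqP eE]; exists x => //; apply: mU; rewrite // eE set21.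
Qed.

Lemma mating_edges_inj m1 m2 :
  mating m2 -> mating_edges m1 = mating_edges m2 -> m1 =1 m2.
Proof.
move=> [m2K _] e x.
have : [set x; m1 x] \in mating_edges m2 by rewrite -e; apply: imset_f.
case/imsetP=> y _ eq; apply: (@set2_injr x); rewrite eq.
have : x \in [set y; m2 y] by rewrite -eq set21.
by case/set2P=> ->; rewrite // m2K setUC.
Qed.

Lemma has_unique_perfect_matchingP :
  has_unique_perfect_matching G <-> exists m, unique_mating m.
Proof.
split=> [[M [pM uM]]|[m [mm um]]].
  have [m mm ME] := perfect_mating_edges pM; exists m; split=> // m' mm'.
  apply: mating_edges_inj => //.
  by rewrite -ME -(uM _ (mating_edges_perfect mm')).
exists (mating_edges m); split; first exact: mating_edges_perfect.
move=> M' /perfect_mating_edges[m' mm' ->].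
by apply: eq_imset => x; rewrite um.
Qed.

(** * Exchange along alternating cycles *)

(** The map [z |-> p^-1 (m (p z))] is again a mating, hence equals [m]. If [p] moves [x], it fixes
    [m (p x)], so this map sends [x] to [m (p x)]; then [m (p x) = m x], a contradiction. *)
Lemma unique_mating_exchange m (p : {perm G}) :
  unique_mating m ->
  (forall x, p x != x -> p (m x) = m x) ->
  (forall x, p x != x -> x -- m (p x)) -> p = 1%g.
Proof.
move=> [[mK me] um] pm pe.
have pmove x : p x != x -> p (p x) != p x by rewrite (inj_eq perm_inj).
have pfix x : p x = x -> p^-1%g x = x by move=> e; rewrite -{1}e permK.
have mm' : mating (fun z => p^-1%g (m (p z))).
  split=> z; first by rewrite permKV mK permK.
  have [pz|pz] := eqVneq (p z) z; last by rewrite pfix ?pe // pm ?pmove.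
  rewrite pz; have [pmz|pmz] := eqVneq (p (m z)) (m z); first by rewrite pfix.
  have := pe (p^-1%g (m z)); rewrite permKV mK sedge_sym; apply.
  by apply: contraNneq pmz => {1}->; rewrite permKV.
apply/permP=> x; rewrite perm1; apply/eqP/idPn => px.
have := um _ mm' x; rewrite pfix; last by rewrite pm ?pmove.
by move/(can_inj mK)=> e; rewrite e eqxx in px.
Qed.

Lemma no_alternating_square m x y :
  unique_mating m -> x -- y -> m x -- m y -> y = m x.
Proof.
move=> um xy mxy; apply/eqP/idPn => ne.
have [[mK me] _] := um.
have nxm z : m z != z by rewrite eq_sym edge_neq.
have xy' : x != m y by apply: contraNneq ne => ->; rewrite mK.
have mxy' : m x != m y by rewrite (can_eq mK) edge_neq.
(* Conjugating by this transposition would replace the edges at [x] and [y] by [x -- y] and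
   [m x -- m y]. *)
have /permP/(_ x) : tperm x (m y) = 1%g.
  apply: (unique_mating_exchange um) => z.
    case: tpermP => [->|->|_ _]; last by rewrite eqxx.
      by rewrite tpermD // 1?eq_sym.
    by rewrite mK tpermD // eq_sym // edge_neq // sedge_sym.
  case: tpermP => [->|->|_ _]; last by rewrite eqxx.
    by rewrite mK.
  by rewrite sedge_sym.
by rewrite tpermL perm1 => e; rewrite e eqxx in xy'.
Qed.

(** A minimal nonempty [f]-stable subset of [S] is permuted by [f]; extended by the identity, this
    permutation contradicts [unique_mating_exchange]. *)
Lemma no_alternating_cycle m (S : {set G}) (f : G -> G) :
  unique_mating m -> {in S, forall x, m x \notin S} ->
  {in S, forall x, [/\ f x \in S, f x != x & x -- m (f x)]} -> S = set0.
Proof.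
move=> um mS fS; apply/eqP/idPn => S0.
pose P (B : {set G}) := [&& B != set0, B \subset S & f @: B \subset B].
have PS : P S.
  rewrite /P S0 subxx; apply/subsetP=> _ /imsetP[x xS ->].
  by case: (fS x xS).
have [B /minsetP[/and3P[B0 BS fB] minB] _] := minset_exists PS.
have fBE : f @: B = B.
  apply: minB => //; rewrite /P (subset_trans fB BS) imsetS // !andbT.
  by case/set0Pn: B0 => x xB; apply/set0Pn; exists (f x); rewrite imset_f.
have finj : {in B &, injective f} by apply/imset_injP; rewrite fBE.
have fBin x : x \in B -> f x \in B by move=> xB; rewrite -fBE imset_f.
have pinj : injective (fun x => if x \in B then f x else x).
  move=> x y; case: ifPn => xB; case: ifPn => yB // e.
  - exact: finj.
  - by rewrite -e fBin in yB.
  - by rewrite e fBin in xB.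
have moved x : perm pinj x != x -> x \in B.
  by rewrite permE; case: ifP => // _; rewrite eqxx.
have p1 : perm pinj = 1%g.
  apply: (unique_mating_exchange um) => x /moved xB; rewrite permE.
    by rewrite ifN //; apply: contra (mS x (subsetP BS x xB)); apply: subsetP.
  by rewrite xB; case: (fS x (subsetP BS x xB)).
case/set0Pn: B0 => x xB; have [_ /eqP + _] := fS x (subsetP BS x xB); apply.
by have /permP/(_ x) := p1; rewrite permE xB perm1.
Qed.

(** * Forcing sequences and the edges they force *)

Lemma remaining_nil : remaining [::] = [set: G].
Proof. by rewrite /remaining big_nil setC0. Qed.

Lemma remaining_rcons s u :
  remaining (rcons s u) = remaining s :\: closed_nbh u.
Proof.
by rewrite /remaining -cats1 big_cat big_seq1 setCU setDE.
Qed.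

(** Separated from the cardinality condition of [forces_in_order] so that it passes to prefixes. *)
Definition forcing s := forall i u, i < size s ->
  has_degree (remaining (take i s)) (nth u s i) 1.

Lemma forcing_rcons s u :
  forcing (rcons s u) <-> forcing s /\ has_degree (remaining s) u 1.
Proof.
have take_rcons i : i <= size s -> take i (rcons s u) = take i s.
  by move=> lei; rewrite -cats1 takel_cat.
split=> [F|[F D] i u0].
  split=> [i u0 lti|].
    have lti' : i < size (rcons s u) by rewrite size_rcons ltnW.
    by have := F i u0 lti'; rewrite nth_rcons lti take_rcons 1?ltnW.
  have lt_s : size s < size (rcons s u) by rewrite size_rcons.
  by have := F _ u lt_s; rewrite nth_rcons ltnn eqxx take_rcons // take_size.
rewrite size_rcons ltnS leq_eqVlt nth_rcons => /orP[/eqP->|lti].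
  by rewrite ltnn eqxx take_rcons // take_size.
by rewrite lti take_rcons 1?ltnW //; apply: F.
Qed.

(** By induction on [s]: the partial mating is the identity on the remaining vertices, so the next
    forced edge is added by composing with a transposition. *)
Lemma forcing_partial_mating s : forcing s ->
  #|remaining s| + 2 * size s = #|G| /\
  exists m, [/\ involutive m, {in remaining s, forall x, m x = x},
    {in ~: remaining s, forall x, x -- m x} &
    forall m', mating m' -> {in ~: remaining s, m' =1 m}].
Proof.
elim/last_ind: s => [_|s u IH /forcing_rcons[/IH{IH}[cs [m [mK mR me mU]]]]].
  rewrite remaining_nil muln0 addn0 cardsT; split=> //.
  by exists id; split=> // [x|m' _ x]; rewrite setCT inE.
rewrite remaining_rcons size_rcons.
move: (remaining s) cs mR me mU => R cs mR me mU [uR /eqP/cards1P[v Nu]].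
have : v \in [set v in R | u -- v] by rewrite Nu set11.
rewrite inE => /andP[vR uv]; have nuv := edge_neq uv.
(* Exactly two vertices disappear, as [v] is the only neighbor of [u] in [R]. *)
have RE : R :\: closed_nbh u = R :\: [set u; v].
  apply/setP=> z; have /setP/(_ z) := Nu.
  rewrite !inE; case: (z \in R) => /=; last by rewrite !andbF.
  by move=> ->.
have mneq z w : w \in R -> z != w -> m z != w.
  by move=> wR; apply: contraNneq => e; rewrite -[z]mK e mR.
split.
  have uvR : [set u; v] \subset R by rewrite subUset !sub1set uR.
  have := subset_leq_card uvR.
  by rewrite RE cardsD (setIidPr uvR) cards2 nuv mulnS addnA => /subnK->.
exists (fun z => m (tperm u v z)); rewrite RE.
have mt z : tperm u v (m z) = m (tperm u v z).
  case: (tpermP u v z) => [->|->|/eqP zu /eqP zv].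
  - by rewrite mR // tpermL mR.
  - by rewrite mR // tpermR mR.
  - by rewrite tpermD // eq_sym mneq.
split=> [z|z|z|m' mm' z].
- by rewrite mt mK tpermK.
- rewrite !inE negb_or => /andP[/andP[zu zv] zR].
  by rewrite tpermD 1?eq_sym // mR.
- rewrite in_setC in_setD negb_and negbK => zP; case: tpermP zP => [->|->|].
  + by rewrite mR.
  + by rewrite mR // sedge_sym.
  move=> /eqP/negPf zu /eqP/negPf zv; rewrite !inE zu zv /= => zR.
  by apply: me; rewrite inE.
have [m'K m'e] := mm'.
(* If [m' u] were outside [R], then [m] would agree with [m'] there and send it to [u], which [m]
   fixes. *)
have m'u : m' u = v.
  apply/set1P; rewrite -Nu inE m'e andbT; apply/idPn=> m'uR.
  have := mU _ mm' (m' u); rewrite inE m'uR m'K => /(_ isT) e.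
  by move: m'uR; rewrite -[m' u]mK -e mR // uR.
rewrite in_setC in_setD negb_and negbK => zP; case: tpermP zP => [->|->|].
- by rewrite mR.
- by rewrite mR // -m'u m'K.
move=> /eqP/negPf zu /eqP/negPf zv; rewrite !inE zu zv /= => zR.
by apply: mU; rewrite // inE.
Qed.

Lemma forces_unique_mating s :
  forces_in_order s -> exists m, unique_mating m.
Proof.
move=> [cG /forcing_partial_mating[]].
rewrite -[X in _ = X]add0n -cG => /eqP; rewrite eqn_add2r cards_eq0 => /eqP R0.
rewrite R0 => -[m [mK _ me mU]]; exists m; split=> [|m' mm' x].
  by split=> // x; apply: me; rewrite !inE.
by apply: mU; rewrite // !inE.
Qed.

(** * From independent transversals to forcing sets *)

Definition transversal m A := forall x, (m x \in A) = (x \notin A).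

(** The order is built greedily, with the invariant that the deleted vertices are those of [s] and
    their mates. *)
Lemma independent_transversal_forces m A :
  unique_mating m -> transversal m A -> independent A ->
  forces_unique_perfect_matching A.
Proof.
move=> um mA indA; have [[mK me] _] := um.
suff step k : k <= #|A| -> exists s, [/\ uniq s, {subset s <= A}, size s = k,
    forcing s & remaining s = [set z | (z \notin s) && (m z \notin s)]].
  have [s [us sA ss fs _]] := step _ (leqnn _).
  exists s; split=> //.
    apply/eqP; rewrite eq_sym eqEcard cardsE (card_uniqP us) ss leqnn andbT.
    by apply/subsetP=> x; rewrite inE => /sA.
  (* [m] maps [A] bijectively onto its complement. *)
  split=> //; rewrite ss mul2n -addnn -(cardsC A); congr (_ + _).
  rewrite -(card_imset A (can_inj mK)); congr #|pred_of_set _|.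
  apply/setP=> x; rewrite inE -mA.
  by apply/idP/imsetP=> [mxA|[y yA ->]]; [exists (m x) | rewrite mK].
elim: k => [_|k IH ltk].
  exists [::]; split=> //.
  by rewrite remaining_nil; apply/setP=> z; rewrite !inE.
have [s [us sA ss fs Rs]] := IH (ltnW ltk).
pose A' := A :\: [set x in s].
(* The default [a] never occurs where [f] is applied: there every element of [A'] is assumed to have
   such a [y]. *)
pose f a := odflt a [pick y in A' | (y != a) && (a -- m y)].
have /existsP[a /andP[aA' /existsPn aN]] :
    [exists a in A', ~~ [exists y in A', (y != a) && (a -- m y)]].
  apply: contraT => /existsPn noa.
  have A'0 : A' = set0.
    apply: (no_alternating_cycle (f := f) um) => x xA'.
      by move: xA'; rewrite !inE mA => /andP[_ ->]; rewrite andbF.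
    have := noa x; rewrite xA' negbK /f => /existsP[y yP].
    by case: pickP => [z /and3P[]//|/(_ y)]; rewrite yP.
  have : #|A| <= size s.
    rewrite cardE uniq_leq_size ?enum_uniq // => x; rewrite mem_enum => xA.
    by have /setP/(_ x) := A'0; rewrite !inE xA andbT => /negbFE.
  by rewrite ss leqNgt ltk.
have [as_ aA] : a \notin s /\ a \in A by move: aA'; rewrite !inE => /andP[].
have mas : m a \notin s by apply: contraL aA => /sA; rewrite mA.
(* By independence [m z] lies in [A], so the choice of [a] leaves only these two cases. Hence [a]
   has degree 1 and its deletion removes just [a] and [m a]. *)
have nbr z : a -- z -> (m z \in s) || (z == m a).
  move=> az; apply/idPn; rewrite negb_or => /andP[mzs zma].
  have zA : z \notin A by apply: contraL az => zA; apply: indA.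
  case/negP: (aN (m z)); rewrite !inE mzs mA zA mK az !andbT.
  by apply: contraNneq zma => <-; rewrite mK.
exists (rcons s a); split.
- by rewrite rcons_uniq as_.
- by move=> x; rewrite mem_rcons inE => /orP[/eqP->|/sA].
- by rewrite size_rcons ss.
- apply/forcing_rcons; split=> //; split; first by rewrite Rs inE as_.
  apply/eqP/cards1P; exists (m a); apply/setP=> z; rewrite Rs !inE.
  apply/idP/eqP=> [/andP[/andP[_ mzs] /nbr]|->]; last by rewrite mas mK as_ me.
  by rewrite (negPf mzs) => /eqP.
rewrite remaining_rcons Rs; apply/setP=> z; rewrite !inE !mem_rcons !inE.
have [->|za] := eqVneq z a; first by [].
have -> : (m z == a) = (z == m a) by apply/eqP/eqP=> [<-|->]; rewrite mK.
have [->|zma] := eqVneq z (m a); first by rewrite me orbT /= ?andbF.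
case az: (a -- z) => //=; have := nbr z az; rewrite (negPf zma) orbF => ->.
by rewrite andbF.
Qed.

End Matchings.

(** * Independent transversals in split graphs and cographs *)

Section Classes.
Variable G : sgraph.
Implicit Types (a b c d x y : G) (m : G -> G).

(** [D] marks the ends to avoid. An edge with no marked end contributes its end of smaller
    [enum_rank], so [A] contains no marked vertex, while every non-matching edge has a marked
    end. *)
Lemma independent_transversal m (D : pred G) : mating m ->
  (forall x, D x -> ~~ D (m x)) ->
  (forall x y, x -- y -> y != m x -> D x || D y) ->
  exists2 A : {set G}, transversal m A & independent A.
Proof.
move=> [mK me] DN De.
pose A := [set x | ~~ D x && (D (m x) || (enum_rank x < enum_rank (m x)))].
have tA : transversal m A.
  move=> x; rewrite !inE mK.
  case Dx: (D x); first by rewrite (negPf (DN x Dx)) ?andbF.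
  case: (D (m x)) => //=.
  rewrite -leqNgt [RHS]leq_eqVlt (inj_eq (@ord_inj _)) (inj_eq enum_rank_inj).
  by rewrite eq_sym (negPf (edge_neq (me x))).
exists A => // x y xA yA; apply/negP=> xy.
have := De x y xy; case: eqVneq yA => [->|_ yA /(_ isT)].
  by rewrite tA xA.
by move: xA yA; rewrite !inE => /andP[/negPf-> _] /andP[/negPf->].
Qed.

(** Mark the mates of vertices of [I]. If [x -- y] had both ends unmarked, [m x] and [m y] would lie
    in the clique and close an alternating square. *)
Lemma split_transversal m : unique_mating m -> split_graph G ->
  exists2 A : {set G}, transversal m A & independent A.
Proof.
move=> um [I [K [IK _ indI cliK]]]; have [[mK me] _] := um.
have KP x : x \notin I -> x \in K.
  by move=> xI; have /setP/(_ x) := IK; rewrite !inE (negPf xI).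
apply: (@independent_transversal m [pred x | m x \in I]) => //= [x mxI|x y xy ne].
  by rewrite mK; apply: contraL (me x) => xI; apply: indI.
apply/idPn; rewrite negb_or => /andP[/KP mxK /KP myK].
have /cliK : m x != m y by rewrite (can_eq mK) edge_neq.
move=> /(_ mxK myK) mxy.
by rewrite (no_alternating_square um xy mxy) eqxx in ne.
Qed.

Lemma cograph_path4 a b c d : cograph G ->
  a -- b -> b -- c -> c -- d -> a != c -> b != d -> a != d ->
  [|| a -- c, a -- d | b -- d].
Proof.
move=> cog ab bc cd nac nbd nad; apply/idPn; rewrite !negb_or.
case/and3P=> /negPf ac /negPf ad /negPf bd.
apply: cog; exists (tnth [tuple a; b; c; d]); split.
  apply/tuple_uniqP.
  rewrite /= !inE !negb_or nac nbd nad.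
  by rewrite (edge_neq ab) (edge_neq bc) (edge_neq cd).
have sE := @sedge_sym G.
move=> [[|[|[|[|//]]]] ?] [[|[|[|[|//]]]] ?].
all: rewrite !(tnth_nth a) /= ?sedge_irrefl //.
all: by rewrite ?ab ?bc ?cd ?ac ?ad ?bd // sE ?ab ?bc ?cd ?ac ?ad ?bd.
Qed.

Definition dominates m x a := [&& a != m x, x -- a & x -- m a].

(* If a vertex of one matching edge is adjacent to a vertex of another one, then
excluding induced 4-paths and alternating 4-cycles leaves exactly two edges
between them, so that one of the four vertices dominates the opposite edge.
As [x] and [m x] cannot both dominate, one can choose a non-dominating end of
each matching edge. *)
Lemma cograph_transversal m : unique_mating m -> cograph G ->
  exists2 A : {set G}, transversal m A & independent A.
Proof.
move=> um cog; have [[mK me] _] := um.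
have square := no_alternating_square um.
have sE := @sedge_sym G.
apply: (@independent_transversal m [pred x | [exists a, dominates m x a]]) => //=.
  (* Suppose [c] dominates the edge of [a] and [m c] that of [e]. Without alternating squares, [c]
     is adjacent to neither end of the latter, nor [m c] to either end of the former. *)
  move=> c /existsP[a /and3P[nad ca ca']]; apply/existsP=> -[e /and3P[]].
  rewrite mK => nec de de'.
  have nac : a != c by rewrite eq_sym edge_neq.
  have nemc : e != m c by rewrite eq_sym edge_neq.
  have mcross x y : x -- y -> m x -- m y -> y == m x.
    by move=> xy mxy; apply/eqP/square.
  have ec : c -- e = false.
    by apply: contraNF nemc => ce; apply: mcross.
  have mec : c -- m e = false.
    by apply: contraNF nec => ce; rewrite -(can_eq mK) mcross // mK.
  have da : m c -- a = false.
    by apply: contraNF nac => da; rewrite -(can_eq mK) mcross // mK.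
  have dma : m c -- m a = false.
    by apply: contraNF nad => dma; apply: mcross.
  have nae : a != e by apply: contraTneq de => <-; rewrite da.
  have nmae : m a != e by apply: contraTneq de => <-; rewrite dma.
  (* The only possible chord of the path [a, c, m c, e] is [a -- e]. Likewise [m a -- m e], which
     yields an alternating square. *)
  have ae : a -- e.
    have := cograph_path4 cog (a := a) (b := c) (c := m c) (d := e).
    by rewrite ec (sE a (m c)) da orbF; apply; rewrite // 1?sE // eq_sym.
  have mae : m a -- m e.
    have := cograph_path4 cog (a := m a) (b := c) (c := m c) (d := m e).
    rewrite mec (sE (m a) (m c)) dma orbF; apply; rewrite ?(can_eq mK) // 1?sE //.
    by apply: contraNneq nemc => ->; rewrite mK.
  by move: (mcross a e ae mae); rewrite eq_sym (negPf nmae).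
(* Of the possible chords of the path [m x, x, y, m y], one closes a square; the others make [y] or
   [x] dominating. *)
move=> x y xy ne.
have nxmy : x != m y by apply: contraNneq ne => ->; rewrite mK.
have := cograph_path4 cog (a := m x) (b := x) (c := y) (d := m y).
rewrite (can_eq mK) (edge_neq xy) (eq_sym (m x)) sE me.
case/(_ isT xy (me y) ne nxmy isT)/or3P=> [mxy|mxy|xmy].
- by apply/orP; right; apply/existsP; exists x; apply/and3P; rewrite !(sE y).
- by rewrite (square x y) ?eqxx in ne.
- by apply/orP; left; apply/existsP; exists y; apply/and3P.
Qed.

End Classes.

Theorem theorem1 (G : sgraph) (hG : cograph G \/ split_graph G) :
  has_unique_perfect_matching G <->
  exists U : {set G}, forces_unique_perfect_matching U.
Proof.
split=> [/has_unique_perfect_matchingP[m um]|[U [s [_ _ Fs]]]].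
  have [A tA iA] : exists2 A : {set G}, transversal m A & independent A.
    by case: hG; [apply: cograph_transversal | apply: split_transversal].
  by exists A; apply: independent_transversal_forces um tA iA.
exact/has_unique_perfect_matchingP/(forces_unique_mating Fs).
Qed.
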